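(* Let $k\ge 1$ be an integer. Then a tree $T$ is a $k$-STI graph if and only if $T\cong K_{1,k+1}$.
   Context: All graphs are simple and connected. $K_{1,k+1}$ is the star with $k+1$ leaves. The transmission of a vertex $u$ of a graph $G$ is $\mathrm{Tr}_G(u)=\sum_{x\in V(G)} d_G(u,x)$, where $d_G$ is the shortest-path distance. For a positive integer $k$, a graph $G$ is a $k$-STI graph if $|\mathrm{Tr}_G(u)-\mathrm{Tr}_G(v)|=k$ for every edge $uv\in E(G)$.
   Formalization: The tree T is additionally assumed to have at least two vertices, because the one-vertex tree has no edges and is vacuously a k-STI graph without being isomorphic to the star with k+1 leaves. *)

(* Defs.v *)
From mathcomp Require Import all_boot all_algebra.

Set Implicit Arguments.
Unset Strict Implicit.
Unset Printing Implicit Defensive.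

Record sgraph := SGraph {
  vertex :> finType;
  edge : rel vertex;
  edge_sym : symmetric edge;
  edge_irr : irreflexive edge
}.
Arguments edge {s} _ _ : rename.

Definition sgraph_iso (G H : sgraph) : Prop :=
  exists2 f : G -> H, bijective f & forall x y : G, edge (f x) (f y) = edge x y.

Definition connected (G : sgraph) : Prop :=
  0 < #|G| /\ forall u v : G, connect edge u v.

(* ucycle accepts [:: x; y] whenever x and y are adjacent, so genuine cycles
   are those on at least three vertices. *)
Definition acyclic (G : sgraph) : Prop :=
  forall c : seq G, 2 < size c -> ~ ucycle edge c.

Definition tree (G : sgraph) : Prop := connected G /\ acyclic G.

Definition walk_of_length (G : sgraph) (u v : G) (n : nat) : bool :=
  [exists p : n.-tuple G, path edge u p && (last u p == v)].

(* The least length of a walk from u to v.  Lengths below #|G| suffice when v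
   is reachable from u (see dist_walk and dist_le); otherwise the value is the
   meaningless #|G|. *)
Definition dist (G : sgraph) (u v : G) : nat :=
  find (walk_of_length u v) (iota 0 #|G|).

Lemma walk_of_lengthP (G : sgraph) (u v : G) (n : nat) :
  reflect (exists p : seq G, [/\ path edge u p, last u p = v & size p = n])
          (walk_of_length u v n).
Proof.
apply: (iffP existsP) => [[p /andP[Pp /eqP Lp]]|[p [Pp Lp /eqP Sp]]].
  by exists p; rewrite size_tuple.
by exists (Tuple Sp); rewrite /= Pp Lp eqxx.
Qed.

Lemma dist_walk (G : sgraph) (u v : G) : connect edge u v ->
  exists p : seq G, [/\ path edge u p, last u p = v & size p = dist u v].
Proof.
case/connectP=> q /shortenP[p Pp Up _] ->.
have Sp : size p < #|G| by have := max_card (mem (u :: p)); rewrite (card_uniqP Up).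
have H : has (walk_of_length u (last u p)) (iota 0 #|G|).
  apply/hasP; exists (size p); first by rewrite mem_iota.
  by apply/walk_of_lengthP; exists p.
apply/walk_of_lengthP; have := nth_find 0 H.
by rewrite nth_iota // -[X in _ < X](size_iota 0) -has_find.
Qed.

Lemma dist_le (G : sgraph) (u v : G) (p : seq G) :
  path edge u p -> last u p = v -> dist u v <= size p.
Proof.
move=> Pp Lp; rewrite leqNgt; apply/negP=> lt_p.
have lt_pG : size p < #|G|.
  by apply: leq_trans lt_p _; rewrite -[X in _ <= X](size_iota 0) find_size.
have := before_find 0 lt_p; rewrite nth_iota // add0n => H.
have W : walk_of_length u v (size p) by apply/walk_of_lengthP; exists p.
by rewrite W in H.
Qed.

Definition transmission (G : sgraph) (u : G) : nat := \sum_(x : G) dist u x.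

(* The difference inside the absolute value is taken in int, not truncated. *)
Definition STI (k : nat) (G : sgraph) : Prop :=
  connected G /\
  forall u v : G, edge u v -> `|transmission u - transmission v|%N = k.

Definition complete_bipartite_edge (m n : nat) : rel ('I_m + 'I_n) :=
  fun x y => match x, y with
             | inl _, inr _ | inr _, inl _ => true
             | _, _ => false
             end.

Lemma complete_bipartite_sym (m n : nat) :
  symmetric (@complete_bipartite_edge m n).
Proof. by move=> [x|x] [y|y]. Qed.

Lemma complete_bipartite_irr (m n : nat) :
  irreflexive (@complete_bipartite_edge m n).
Proof. by move=> [x|x]. Qed.

Definition complete_bipartite (m n : nat) : sgraph :=
  SGraph (@complete_bipartite_sym m n) (@complete_bipartite_irr m n).

(* Main.v *)
Require Import Defs.
From mathcomp Require Import all_boot all_algebra.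
From mathcomp Require Import zify.

(** Transmissions of the two ends of an edge [u v] differ by at most [#|G| - 2],
    with equality if [u] is a leaf; if neither end is a leaf and the graph has
    no triangle, they differ by at most [#|G| - 4].  A tree has a leaf, so a
    [k]-STI tree has [k + 2] vertices and every edge of it has a leaf end,
    which makes it a star. *)

Definition pendant (G : sgraph) (u v : G) : bool :=
  edge u v && [forall w, edge u w ==> (w == v)].

Lemma pendantP (G : sgraph) (u v : G) :
  reflect (edge u v /\ forall w, edge u w -> w = v) (pendant G u v).
Proof.
apply: (iffP andP) => -[uv H]; split=> //.
  by move=> w uw; apply/eqP/(implyP (forallP H w)).
by apply/forallP => w; apply/implyP => /H ->.
Qed.

Lemma not_pendant (G : sgraph) (u v : G) :
  edge u v -> ~~ pendant G u v -> exists2 w, edge u w & w != v.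
Proof.
rewrite /pendant => -> /= /forallPn[w]; rewrite negb_imply => /andP[].
by exists w.
Qed.

Lemma dist_refl (G : sgraph) (u : G) : dist u u = 0.
Proof. by apply/eqP; rewrite -leqn0; apply: (@dist_le G u u [::]). Qed.

Lemma dist_edge_le (G : sgraph) (u v x : G) :
  connected G -> edge u v -> dist u x <= (dist v x).+1.
Proof.
case=> _ cG uv; have [p [Pp Lp <-]] := dist_walk (cG v x).
by apply: (@dist_le G u x (v :: p)); rewrite /= ?uv.
Qed.

Lemma dist_gt0 (G : sgraph) (u v : G) :
  connected G -> u != v -> 0 < dist u v.
Proof.
case=> _ cG; have [[|w p] [_ Lp <-]] := dist_walk (cG u v) => //.
by rewrite -Lp /= eqxx.
Qed.

Lemma dist_gt1 (G : sgraph) (u v : G) :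
  connected G -> u != v -> ~~ edge u v -> 1 < dist u v.
Proof.
case=> _ cG; have [[|w [|w' p]] [Pp Lp <-]] := dist_walk (cG u v) => //.
  by rewrite -Lp /= eqxx.
by move: Pp; rewrite -Lp /= andbT => ->.
Qed.

Lemma edge_neq (G : sgraph) (u v : G) : edge u v -> u != v.
Proof. by apply: contraTneq => ->; rewrite edge_irr. Qed.

Lemma dist_edge (G : sgraph) (u v : G) :
  connected G -> edge u v -> dist u v = 1.
Proof.
move=> cG uv; apply/eqP; rewrite eqn_leq dist_gt0 ?edge_neq // andbT.
by have := dist_edge_le G u v v cG uv; rewrite dist_refl.
Qed.

(** A walk leaving [u] has to step to [v] first, so deleting that step gives the lower bound on
    [dist u x]. *)
Lemma dist_pendant (G : sgraph) (u v x : G) :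
  connected G -> pendant G u v -> x != u -> dist u x = (dist v x).+1.
Proof.
move=> cG /pendantP[uv H] xu; apply/eqP; rewrite eqn_leq dist_edge_le //=.
have [[|w p] [Pp Lp <-]] := dist_walk (cG.2 u x).
  by rewrite -Lp /= eqxx in xu.
by move: Pp Lp => /= /andP[/H -> Pp] Lp; apply: dist_le.
Qed.

(** The [#|G| - 1] vertices other than [u] each contribute one more to the sum at [u], while [u]
    itself contributes 0 there and 1 at [v]. The additive form avoids truncated subtraction. *)
Lemma transmission_pendant (G : sgraph) (u v : G) :
  connected G -> pendant G u v ->
  transmission u + 2 = transmission v + #|G|.
Proof.
move=> cG uv; have [e _] := pendantP _ _ _ uv.
rewrite -sum1_card /transmission -big_split /= !(bigD1 u (P := xpredT)) //=.
rewrite dist_refl dist_edge ?[edge v u]edge_sym // addnC; congr (_ + _).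
by apply: eq_bigr => x xu; rewrite (dist_pendant _ _ _ _ cG uv xu) addn1.
Qed.

(** Passing from [v] to [u] gains at most 1 at each of the [#|G| - 2] vertices other than [u] and
    [w], and loses at least 1 at both [u] and [w]. *)
Lemma transmission_not_pendant (G : sgraph) (u v w : G) :
  connected G -> edge u v -> edge u w -> w != v -> ~~ edge v w ->
  transmission u + 4 <= transmission v + #|G|.
Proof.
move=> cG uv uw wv vw; have wu : w != u by rewrite eq_sym edge_neq.
rewrite -sum1_card /transmission -big_split /= !(bigD1 u (P := xpredT)) //=.
rewrite !(bigD1 w (P := fun x => x != u)) //=.
have le_rest : \sum_(x | (x != u) && (x != w)) dist u x <=
    \sum_(x | (x != u) && (x != w)) (dist v x + 1).
  by apply: leq_sum => x _; rewrite addn1 dist_edge_le.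
have dvw : 1 < dist v w by apply: dist_gt1; rewrite // eq_sym.
rewrite dist_refl (dist_edge _ _ _ cG uw) (dist_edge G v u) ?[edge v u]edge_sym //.
lia.
Qed.

(* The first vertex of a longest simple path is a leaf: its neighbours all lie
   on the path, and one other than the second vertex would close a cycle. *)
Lemma exists_pendant (G : sgraph) :
  connected G -> acyclic G -> 1 < #|G| -> exists u v : G, pendant G u v.
Proof.
move=> cG aG G2.
pose P n := [exists u : G, exists p : n.-tuple G,
               path edge u p && uniq (u :: p)].
have exP : exists n, P n.
  have [u _] := (card_gt0P cG.1).
  by exists 0; apply/existsP; exists u; apply/existsP; exists [tuple].
have ubP n : P n -> n <= #|G|.
  case/existsP=> u /existsP[p /andP[_ Up]].
  have := max_card (mem (u :: p)).
  by rewrite (card_uniqP Up) /= size_tuple => /ltnW.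
case: (ex_maxnP exP ubP) => n /existsP[u /existsP[[p /= /eqP <-]]] /andP[Pp Up] maxn.
have inp w : edge u w -> w \in p.
  move=> uw; apply: contraT => wp.
  (* Otherwise prepending [w] would give a longer simple path. *)
  suff /maxn : P (size p).+1 by rewrite ltnn.
  apply/existsP; exists w; apply/existsP; exists [tuple of u :: in_tuple p].
  move: Up; rewrite /= [edge w u]edge_sym uw Pp inE negb_or wp => ->.
  by rewrite eq_sym edge_neq.
have [v uv] : exists v, edge u v.
  have [x /andP[xu _]] : exists x, (x != u) && (x \in G).
    have /card_gt0P[x] : 0 < #|predC1 u| by rewrite cardC1 -subn1 subn_gt0.
    by rewrite !inE => xu; exists x; rewrite xu.
  have [[|v q] [Pq Lq _]] := dist_walk (cG.2 u x).
    by rewrite -Lq /= eqxx in xu.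
  by case/andP: Pq => uv _; exists v.
have hdp w : edge u w -> w = head u p.
  move=> uw; have wp := inp w uw; have {}Up : uniq (u :: p) by [].
  (* If [w] is not the head of [p], the part of the path from [u] to [w] has at least three
     vertices, and the edge from [w] to [u] closes it. *)
  case/splitPr: wp Pp Up => [[|a p1] p2] //.
  rewrite -cat_rcons cat_path -cat_cons cat_uniq => /andP[Pp _] /andP[Up _].
  case: (aG (u :: rcons (a :: p1) w)); first by rewrite /= size_rcons.
  by rewrite /ucycle Up andbT /cycle rcons_path Pp last_rcons edge_sym.
by exists u, v; apply/pendantP; split=> // w /hdp ->; rewrite (hdp v).
Qed.

Lemma acyclic_triangle_free (G : sgraph) (u v w : G) :
  acyclic G -> edge u v -> edge u w -> ~~ edge v w.
Proof.
move=> aG uv uw; apply/negP => vw; apply: (aG [:: u; v; w]) => //.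
rewrite /ucycle /= uv vw [edge w u]edge_sym uw !inE negb_or.
by rewrite !edge_neq.
Qed.

(** Both directions of the theorem use this intrinsic form, with a centre [c] and the exclusive or
    as adjacency, instead of handling an isomorphism. *)
Lemma star_isoP (G : sgraph) (m : nat) :
  sgraph_iso G (complete_bipartite 1 m) <->
  #|G| = m.+1 /\ exists c : G, forall x y, edge x y = (x == c) (+) (y == c).
Proof.
split=> [[f bij_f fE]|[cardG [c cE]]].
  split; first by rewrite (bij_eq_card bij_f) card_sum !card_ord.
  have [g fK gK] := bij_f; exists (g (inl ord0)) => x y.
  rewrite -fE -!(can2_eq fK gK).
  by case: (f x) (f y) => [i|i] [j|j]; rewrite ?[i]ord1 ?[j]ord1.
pose s := enum (predC1 c).
have mem_s x : (x \in s) = (x != c) by rewrite mem_enum.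
have size_s : size s = m by rewrite -cardE cardC1 cardG.
have index_s x : x != c -> index x s < m by rewrite -size_s index_mem mem_s.
(* Since [c] is not in [s], its index is [size s = m], out of range for ['I_m], so [insub] fails
   exactly at the centre. *)
pose f x : complete_bipartite 1 m :=
  if insub (index x s) is Some i then inr i else inl ord0.
have fc : f c = inl ord0.
  rewrite /f insubF // -size_s index_mem mem_s eqxx //.
have fN x (xc : x != c) : f x = inr (Ordinal (index_s x xc)).
  by rewrite /f (insubT (fun i => i < m) (index_s x xc)).
exists f => [|x y].
  apply: inj_card_bij; last by rewrite card_sum !card_ord cardG.
  move=> x y; have [->|xc] := eqVneq x c; have [->|yc] := eqVneq y c => //.
  - by rewrite fc fN.
  - by rewrite fc fN.
  rewrite !fN => -[eq_i].
  by rewrite -(nth_index c (s := s) (x := x)) ?mem_s // eq_i nth_index ?mem_s.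
rewrite cE; have [->|xc] := eqVneq x c; have [->|yc] := eqVneq y c;
  by rewrite ?fc ?fN.
Qed.

(** The centre is the neighbour [c] of some leaf [u]. The closed neighbourhood of [c] is stable
    under adjacency, hence everything by connectedness; two neighbours of [c] are not adjacent, as
    there is no triangle. *)
Lemma pendant_edges_star (G : sgraph) :
  connected G -> acyclic G -> 1 < #|G| ->
  (forall u v : G, edge u v -> pendant G u v || pendant G v u) ->
  exists c : G, forall x y, edge x y = (x == c) (+) (y == c).
Proof.
move=> cG aG G2 pE; have [u [c uc]] := exists_pendant G cG aG G2.
have [_ uN] := pendantP _ _ _ uc; exists c.
have step y z : (y == c) || edge c y -> edge y z -> (z == c) || edge c z.
  case: eqVneq => [-> _ ->|yc /= cy yz]; first by rewrite orbT.
  have [//|zc /=] := eqVneq z c.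
  (* If [y] is the leaf of the edge [c y], then [z = c]. If [c] is, then [y] is its only neighbour
     [u], and again [z = c]. *)
  have /orP[/pendantP[_ cN]|/pendantP[_ yN]] := pE _ _ cy; last first.
    by rewrite (yN z yz) eqxx in zc.
  have yu : y = u.
    by rewrite (cN u) // edge_sym; case/andP: uc.
  by rewrite -(uN z) ?eqxx -?yu // in zc.
have adj_path p y : (y == c) || edge c y -> path edge y p ->
    (last y p == c) || edge c (last y p).
  elim: p y => //= z p IH y cy /andP[yz]; apply: IH; exact: step cy yz.
have adj x : x != c -> edge c x.
  move=> xc; have /connectP[p Pp Lp] := cG.2 c x.
  by have := adj_path p c; rewrite -Lp eqxx (negPf xc); apply.
move=> x y; have [->|xc] := eqVneq x c; have [->|yc] := eqVneq y c => /=.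
- by rewrite edge_irr.
- by rewrite adj.
- by rewrite edge_sym adj.
- by apply/negbTE/(acyclic_triangle_free G c x y aG); apply: adj.
Qed.

(* The one-vertex tree has no edge, hence is vacuously a k-STI graph for every
   k without being a star K_(1,k+1): it has to be excluded. *)
Theorem corollary2p3 (k : nat) (hk : 1 <= k) (T : sgraph)
    (hT : tree T) (hT2 : 2 <= #|T|) :
  STI k T <-> sgraph_iso T (complete_bipartite 1 k.+1).
Proof.
have [cT aT] := hT; rewrite star_isoP; split=> [[_ stiT]|[cardT [c cE]]].
  have [u [c uc]] := exists_pendant T cT aT hT2.
  have cardT : #|T| = k.+2.
    have := stiT u c; have := transmission_pendant _ _ _ cT uc.
    case/andP: uc => uc _ ? /(_ uc); lia.
  split=> //; apply: pendant_edges_star => // x y xy.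
  (* With no leaf end, the transmissions would differ by at most [#|T| - 4 = k - 2] in either
     direction. *)
  apply: contraT; rewrite negb_or => /andP[xN yN].
  have yx : edge y x by rewrite edge_sym.
  have [w xw wy] := not_pendant _ _ _ xy xN.
  have [z yz zx] := not_pendant _ _ _ yx yN.
  have := transmission_not_pendant _ _ _ _ cT xy xw wy
    (acyclic_triangle_free _ _ _ _ aT xy xw).
  have := transmission_not_pendant _ _ _ _ cT yx yz zx
    (acyclic_triangle_free _ _ _ _ aT yx yz).
  have := stiT x y xy; lia.
split=> // u v; rewrite cE.
(* Every edge of the star joins a leaf to [c], so the difference is [#|T| - 2 = k]. *)
have pendant_c x : x != c -> pendant T x c.
  move=> xc; apply/pendantP; rewrite cE (negPf xc) eqxx; split=> // w.
  by rewrite cE (negPf xc) => /eqP.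
have [->|uc] := eqVneq u c; have [->|vc] := eqVneq v c => // _.
- have := transmission_pendant _ _ _ cT (pendant_c v vc); lia.
- have := transmission_pendant _ _ _ cT (pendant_c u uc); lia.
Qed.
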